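(* Consider integers $n,\tau\in\mathbb Z_{+}$ such that $n\ge3\tau$, as well as a pair of functions $\mathsf E:\{0,1\}^n\to\{0,1\}^*$ and $\mathsf D:\{0,1\}^*\to2^{[0..n)}$ jointly satisfying the following property: for every $T\in\{0,1\}^n$, the set $\mathsf D(\mathsf E(T))$ is a $\tau$-synchronizing set of $T$. Then, there exists $T\in\{0,1\}^n$ such that $|\mathsf E(T)|=\Omega\left(\frac n\tau\lg\tau\right)$.
   Context: Notation: $\mathbb Z_+$ is the set of positive integers; $[i..j]=\{h\in\mathbb Z: i\le h\le j\}$, $[i..j)=[i..j-1]$; $2^{X}$ is the power set of $X$; $\{0,1\}^*$ is the set of all finite bit strings; $|B|$ is the length of a bit string $B$; $\lg x=\log_2\max(1,x)$. Strings are indexed from $0$; $T[i..j)$ denotes $T[i]T[i+1]\cdots T[j-1]$. Periods: an integer $p\in[1..|S|]$ is a period of a string $S$ if $S[i]=S[i+p]$ for all $i\in[0..|S|-p)$; $\mathrm{per}(S)$ is the smallest period of a non-empty string $S$. Synchronizing set: for a string $T[0..n)$ and $\tau\in[1..\lfloor n/2\rfloor]$, a set $\mathsf{Sync}\subseteq[0..n-2\tau]$ is a $\tau$-synchronizing set of $T$ if it satisfies the following two conditions: (Consistency) for $i,j\in[0..n-2\tau]$, if $i\in\mathsf{Sync}$ and the strings $T[i..i+2\tau)$ and $T[j..j+2\tau)$ are identical, then $j\in\mathsf{Sync}$; (Density) for $i\in[0..n-3\tau+1]$, $[i..i+\tau)\cap\mathsf{Sync}=\emptyset$ if and only if $\mathrm{per}(T[i..i+3\tau-1))\le\frac13\tau$.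 Here $\mathsf E$ models an algorithm mapping an input string $T$ to an encoding of some $\tau$-synchronizing set of $T$, and $\mathsf D$ is the accompanying decoding function that recovers the set from the encoding alone.
   Formalization: The bound is proved for τ ≠ 2 and n ≥ (3+ε)τ, for any fixed ε > 0, with the constant in Ω depending only on ε; as stated it fails for τ = 2 (the empty encoding works) and for n = 3τ with τ large (two bits suffice). *)

(* Defs.v *)
From mathcomp Require Import all_boot all_order all_algebra.
From mathcomp Require Import reals exp.

Set Implicit Arguments.
Unset Strict Implicit.
Unset Printing Implicit Defensive.

Import Order.TTheory GRing.Theory Num.Theory.

(* The substring S[i..j). *)
Definition substr (S : seq bool) (i j : nat) : seq bool :=
  take (j - i) (drop i S).

Definition is_period (S : seq bool) (p : nat) : bool :=
  (1 <= p <= size S) &&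
  [forall i : 'I_(size S - p), nth false S i == nth false S (i + p)].

(* The default ord_max stands for size S, which is a period of S as soon as S
   is non-empty; per [::] is a junk value. *)
Definition per (S : seq bool) : nat :=
  [arg min_(p < @ord_max (size S) | is_period S p) (p : nat)].

(* Index ranges are written without truncated subtraction: i <= n - 2 tau and
   i <= n - 3 tau + 1 become i + 2 tau <= n and i + 3 tau <= n + 1. *)
Definition synchronizing_set (n tau : nat) (T : n.-tuple bool)
    (Sync : {set 'I_n}) : Prop :=
  [/\ 1 <= tau <= n %/ 2,
      forall i : 'I_n, i \in Sync -> i + 2 * tau <= n,
      forall i j : 'I_n, i + 2 * tau <= n -> j + 2 * tau <= n ->
        i \in Sync ->
        substr T i (i + 2 * tau) = substr T j (j + 2 * tau) ->
        j \in Sync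
    & forall i : nat, i + 3 * tau <= n + 1 ->
        ([set j : 'I_n | i <= j < i + tau] :&: Sync = set0
         <-> 3 * per (substr T i (i + 3 * tau - 1)) <= tau)].

Definition lg (R : realType) (x : R) : R :=
  (ln (Num.max 1 x) / ln 2)%R.

(* Main.v *)
Require Import Defs.
From mathcomp Require Import all_boot all_order all_algebra.
From mathcomp Require Import reals exp.
From mathcomp Require Import zify lra.

(** By density, a synchronizing set determines the positions i at which the
window T[i..i+3tau-1) has period at most tau/3. If the ones of T are pairwise
more than tau/3 apart, these are exactly the positions whose window contains no
one. Put a single one in each block of length 4 tau, at any of the first w
offsets: just after each one there is a zero window, so the synchronizing set
determines all the offsets. Here w = min(tau, n - 3 tau + 1), the second bound
being what the last window leaves when n < 4 tau; since n - 3 tau >= eps tau,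
Bernoulli's inequality gives tau <= w ^ K for any K >= 1/eps. With m >= n/(8 tau)
blocks, the w ^ m strings need distinct codewords, one of which has length at
least (m lg w) / 2. *)

Set Implicit Arguments.
Unset Strict Implicit.
Unset Printing Implicit Defensive.

Import Order.TTheory GRing.Theory Num.Theory.
Local Open Scope nat_scope.

Lemma perP (S : seq bool) : 0 < size S ->
  is_period S (per S) /\ forall p, is_period S p -> per S <= p.
Proof.
move=> S_gt0; rewrite /per; case: arg_minnP => [|p Pp p_min].
  rewrite /is_period /= S_gt0 leqnn /=; apply/forallP => -[i].
  by rewrite subnn.
split=> // q Pq; have q_lt : q < (size S).+1 by case/andP: Pq => /andP[].
exact: (p_min (Ordinal q_lt)).
Qed.

Lemma per_nseq k b : per (nseq k.+1 b) <= 1.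
Proof.
have [|_] := @perP (nseq k.+1 b); first by rewrite size_nseq.
apply; apply/andP; rewrite size_nseq; split=> //; apply/forallP => -[i lt_i].
by apply/eqP; rewrite !nth_nseq; do 2 case: ifP => //=; lia.
Qed.

(** If a period p were at most d, then a + p or a - p would be a position of [S], since
    [2 * d <= size S], and it would hold a one too close to a. *)
Lemma per_isolated (S : seq bool) a d : 2 * d <= size S -> nth false S a ->
  (forall b, nth false S b -> a < b -> a + d < b) ->
  (forall b, nth false S b -> b < a -> b + d < a) ->
  d < per S.
Proof.
move=> le_d Sa Sgt Slt; have a_lt : a < size S.
  by rewrite ltnNge; apply/negP => /(nth_default false); rewrite Sa.
have [|/andP[/andP[p_gt0 _] /forallP perS] _] := @perP S; first by lia.
rewrite ltnNge; apply/negP => le_p.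
have shift i : i + per S < size S -> nth false S i = nth false S (i + per S).
  move=> lt_i; have lt_i' : i < size S - per S by lia.
  exact/eqP/(perS (Ordinal lt_i')).
have [lt_ap|le_ap] := ltnP (a + per S) (size S).
  by have := Sgt (a + per S); rewrite -shift // => /(_ Sa); lia.
have pa : a - per S + per S = a by lia.
by have := Slt (a - per S); rewrite shift pa // => /(_ Sa); lia.
Qed.

Lemma size_substr S i j : j <= size S -> size (substr S i j) = j - i.
Proof. by move=> le_j; rewrite size_take size_drop; case: ifP; lia. Qed.

Lemma nth_substr S i j k :
  nth false (substr S i j) k = (k < j - i) && nth false S (i + k).
Proof.
rewrite /substr; have [lt_k|le_k] := ltnP; first by rewrite nth_take ?nth_drop.
by rewrite nth_default // size_take; case: ifP; lia.
Qed.

(** By density, both inequalities say that [Sync] misses [i..i+tau). *)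
Lemma sync_per_eq n tau (T T' : n.-tuple bool) Sync i :
  synchronizing_set tau T Sync -> synchronizing_set tau T' Sync ->
  i + 3 * tau <= n + 1 ->
  3 * per (substr T i (i + 3 * tau - 1)) <= tau ->
  3 * per (substr T' i (i + 3 * tau - 1)) <= tau.
Proof. by case=> _ _ _ d [_ _ _ d'] le_i /(d i le_i) /(d' i le_i). Qed.

Definition mark tau (g : nat -> nat) i := i %% (4 * tau) == g (i %/ (4 * tau)).

Definition marked n tau g : n.-tuple bool := [tuple mark tau g i | i < n].

Lemma nth_marked n tau g i : nth false (marked n tau g) i = (i < n) && mark tau g i.
Proof.
have [lt_i|le_i] := ltnP; last by rewrite nth_default // size_tuple.
by rewrite -[i]/(val (Ordinal lt_i)) -tnth_nth tnth_mktuple.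
Qed.

(** Each block of length 4 tau has its only one among its first tau positions. *)
Lemma mark_gap tau g i i' : (forall j, g j < tau) ->
  mark tau g i -> mark tau g i' -> i < i' -> i + 3 * tau < i'.
Proof.
move=> g_lt /eqP gi /eqP gi'.
have := divn_eq i (4 * tau); have := divn_eq i' (4 * tau); rewrite gi gi'.
move: (i %/ _) (i' %/ _) => q q' -> ->.
have := g_lt q; have := g_lt q'.
have [lt_q|gt_q|->] := ltngtP q q'; last by lia.
  by have := leq_mul2r (4 * tau) q.+1 q'; rewrite lt_q orbT mulSn; lia.
by have := leq_mul2r (4 * tau) q'.+1 q; rewrite gt_q orbT mulSn; lia.
Qed.

Lemma mark_block tau g j : g j < tau -> mark tau g (j * (4 * tau) + g j).
Proof.
move=> lt_g; have lt_g4 : g j < 4 * tau by lia.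
by rewrite /mark modnMDl divnMDl ?modn_small ?divn_small ?addn0 //; lia.
Qed.

(** Were g j < g' j, the window just after the one of g in block j would be all zeros for g but
    contain an isolated one for g', against [sync_per_eq]. Used both ways round, this gives equal
    offsets. *)
Lemma marked_offset_le n tau g g' Sync j : 2 < tau ->
  (forall j, g j < tau) -> (forall j, g' j < tau) ->
  j * (4 * tau) + g j + 3 * tau <= n ->
  synchronizing_set tau (marked n tau g) Sync ->
  synchronizing_set tau (marked n tau g') Sync ->
  g' j <= g j.
Proof.
move=> tau_gt2 g_lt g'_lt; have := mark_block (g_lt j).
have := mark_block (g'_lt j); have := g'_lt j.
set p' := _ + g' j; set p := _ + g j => g'j_lt mp' mp le_p sync sync'.
rewrite leqNgt; apply/negP => lt_g.
have lt_p : p < p' by rewrite ltn_add2l.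
have lt_p' : p' < p + tau by rewrite /p /p'; lia.
have := sync_per_eq (i := p.+1) sync sync'.
rewrite (_ : substr _ _ _ = nseq (3 * tau - 2).+1 false); last first.
  have sz : size (substr (marked n tau g) p.+1 (p.+1 + 3 * tau - 1))
      = (3 * tau - 2).+1 by rewrite size_substr ?size_tuple; lia.
  apply: (@eq_from_nth _ false) => [|k _]; first by rewrite sz size_nseq.
  rewrite nth_substr nth_nseq if_same nth_marked; apply/negP => /and3P[lt_k _ mk].
  by have := mark_gap g_lt mp mk; lia.
(* The zero window has period 1, at most tau / 3 because tau > 2. *)
have := per_nseq (3 * tau - 2) false.
suff : tau %/ 3 < per (substr (marked n tau g') p.+1 (p.+1 + 3 * tau - 1)) by lia.
have pE : p.+1 + (p' - p.+1) = p' by lia.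
apply: (@per_isolated _ (p' - p.+1)).
- by rewrite size_substr ?size_tuple; lia.
- by rewrite nth_substr nth_marked pE mp'; lia.
- move=> b; rewrite nth_substr nth_marked => /and3P[_ _ mb] lt_b.
  by have := mark_gap g'_lt mp' mb; lia.
- move=> b; rewrite nth_substr nth_marked => /and3P[_ _ mb] lt_b.
  by have := mark_gap g'_lt mb mp'; lia.
Qed.

Lemma card_short_codes (A : finType) (h : A -> seq bool) k :
  injective h -> (forall a, size (h a) <= k) -> #|A| < 2 ^ k.+1.
Proof.
move=> h_inj h_le.
(* Padding to length k+1 by 0...01 misses the zero word. *)
pose pad s := nseq (k - size s) false ++ true :: s.
pose code (o : option A) := if o is Some a then pad (h a) else nseq k.+1 false.
have code_size o : size (code o) == k.+1.
  case: o => [a|] /=; last by rewrite size_nseq.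
  by rewrite size_cat size_nseq /= addnS subnK.
(* The first one ends the padding, so the word can be read back. *)
have padK s : drop (index true (pad s)).+1 (pad s) = s.
  rewrite /pad index_cat mem_nseq andbF /= addn0 size_nseq.
  by rewrite -cat_rcons drop_size_cat // size_rcons size_nseq.
have true_pad s : true \in pad s by rewrite mem_cat in_cons eqxx orbT.
have no_true : true \in nseq k.+1 false = false by rewrite mem_nseq andbF.
(* [None] takes the zero word, which makes the bound strict. *)
rewrite -card_option -card_bool -card_tuple.
apply: (@leq_card _ _ (fun o => Tuple (code_size o))).
move=> [a|] [b|] // /(congr1 val) /= eq_ab.
- by congr Some; apply: h_inj; rewrite -[LHS]padK eq_ab padK.
- by move: (true_pad (h a)); rewrite eq_ab no_true.
- by move: (true_pad (h b)); rewrite -eq_ab no_true.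
Qed.

Lemma expn_Bernoulli d K : 1 + K * d <= (1 + d) ^ K.
Proof.
elim: K => // K IH; rewrite expnS mulSn.
by apply: leq_trans (leq_mul (leqnn (1 + d)) IH); lia.
Qed.

(** The bounds stay in integers; in logarithms the second reads m lg tau <= 2 K |E T|. *)
Lemma long_encoding n tau K (E : n.-tuple bool -> seq bool) (D : seq bool -> {set 'I_n}) :
  2 < tau -> 3 * tau <= n -> tau <= K * (n - 3 * tau) ->
  (forall T, synchronizing_set tau T (D (E T))) ->
  exists m T, n <= 8 * (m * tau) /\ tau ^ m <= 2 ^ (2 * size (E T) * K).
Proof.
move=> tau_gt2 le_n tau_le sync.
(* The blocks are 0..m: all the complete ones, or block 0 alone if n < 4 tau. Here [w] is the
   largest offset, so there are [w.+1] choices per block. *)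
pose m := (n %/ (4 * tau)).-1; pose w := minn tau.-1 (n - 3 * tau).
have /andP[K_gt0 d_gt0] : (0 < K) && (0 < n - 3 * tau).
  by rewrite -muln_gt0; apply: leq_trans tau_le; lia.
have w_gt0 : 0 < w by rewrite leq_min d_gt0; lia.
have wK : tau <= w.+1 ^ K.
  rewrite /w /minn; case: ifP => _.
    by rewrite prednK ?(ltnW (ltnW tau_gt2)) // -{1}[tau]expn1 leq_pexp2l; lia.
  rewrite -[_.+1]add1n; apply: leq_trans (expn_Bernoulli _ K).
  by rewrite (leq_trans tau_le) ?leq_addl.
(* [inord] sends each j > m to 0, so later blocks also get an offset at most [w]. *)
pose g (f : {ffun 'I_m.+1 -> 'I_w.+1}) j : nat := f (inord j).
have g_le f j : g f j <= w by rewrite -ltnS ltn_ord.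
have g_lt f j : g f j < tau by have := g_le f j; rewrite /w; lia.
have g_fit f j : j <= m -> j * (4 * tau) + g f j + 3 * tau <= n.
  move=> le_j; have := g_le f j; rewrite leq_min => /andP[gj gj'].
  (* Block 0 may be incomplete and relies on w <= n - 3 tau; a later one is complete and its offset
     is below tau. *)
  have [j0|j_gt0] := posnP j; first by rewrite j0 in gj' *; lia.
  have : j.+1 * (4 * tau) <= n by rewrite -leq_divRL; move: le_j; rewrite /m; case: (n %/ _); lia.
  by rewrite mulSn; lia.
pose h f := E (marked n tau (g f)).
have h_inj : injective h.
  move=> f f' eq_h; apply/ffunP => j; apply/val_inj/eqP.
  have sf := sync (marked n tau (g f)).
  have sf' := sync (marked n tau (g f')); rewrite -/(h f') -eq_h in sf'.
  have := marked_offset_le tau_gt2 (g_lt f) (g_lt f') (g_fit f _ (leq_ord j)) sf sf'.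
  have := marked_offset_le tau_gt2 (g_lt f') (g_lt f) (g_fit f' _ (leq_ord j)) sf' sf.
  by rewrite /g inord_val eqn_leq /= => -> ->.
have [|f0 f0_max] := @bigop.eq_bigmax _ (fun f => size (h f)).
  by rewrite card_ffun !card_ord expn_gt0.
have h_le f : size (h f) <= size (h f0).
  by rewrite -f0_max; apply: (bigop.leq_bigmax (F := fun f => size (h f))).
have := card_short_codes h_inj h_le; rewrite card_ffun !card_ord.
set k := size (h f0) => lt_k.
(* There are at least two codewords, so the longest is non-empty and k + 1 <= 2 k. *)
have k_gt0 : 0 < k.
  have : w.+1 <= w.+1 ^ m.+1 by rewrite -{1}[w.+1]expn1 leq_pexp2l.
  by case: (k) lt_k; lia.
exists m.+1, (marked n tau (g f0)); split.
  (* With q the quotient, n < 4 tau (q + 1) and q + 1 <= 2 (m + 1). *)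
  have := divn_eq n (4 * tau); have := @ltn_pmod n (4 * tau).
  by rewrite /m; case: (n %/ _); lia.
rewrite -/(h f0) -/k expnM.
apply: (@leq_trans ((w.+1 ^ K) ^ m.+1)); first by rewrite leq_exp2r.
rewrite -expnM mulnC expnM leq_exp2r //; apply: ltnW; apply: leq_trans lt_k _.
by rewrite leq_exp2l //; lia.
Qed.

Local Open Scope ring_scope.

Theorem lemma6p1 (R : realType) (eps : R) (eps_gt0 : 0 < eps) :
  exists2 c : R, 0 < c &
  forall n tau : nat, (0 < n)%N -> (0 < tau)%N -> (3 * tau <= n)%N ->
  tau <> 2%N -> (3 + eps) * tau%:R <= n%:R :> R ->
  forall (E : n.-tuple bool -> seq bool) (D : seq bool -> {set 'I_n}),
  (forall T : n.-tuple bool, synchronizing_set tau T (D (E T))) ->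
  exists T : n.-tuple bool,
    c * (n%:R / tau%:R * lg tau%:R) <= (size (E T))%:R :> R.
Proof.
pose K := Num.bound eps^-1.
have K_gt : eps^-1 < K%:R by apply: archi_boundP; rewrite invr_ge0 ltW.
have K_gt0 : 0 < K%:R :> R by apply: lt_trans K_gt; rewrite invr_gt0.
have Keps : 1 <= K%:R * eps.
  by rewrite -ler_pdivrMr // div1r ltW.
(* The 8 of n <= 8 m tau times the 2 K of the exponent in [long_encoding]. *)
exists (16 * K%:R)^-1 => [|n tau n_gt0 tau_gt0 le_n tau_neq2 le_eps E D sync].
  by rewrite invr_gt0 mulr_gt0.
have tauR : 0 < tau%:R :> R by rewrite ltr0n.
have maxE : Num.max 1 tau%:R = tau%:R :> R by apply/max_idPr; rewrite ler1n.
rewrite /lg maxE.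
(* For tau = 1 the bound is 0, as lg 1 = 0, and any string will do. *)
have [tau1|tau_gt1] := leqP tau 1.
  have -> : tau = 1%N by lia.
  by exists [tuple of nseq n false]; rewrite ln1 mul0r !mulr0 ler0n.
have tau_le : (tau <= K * (n - 3 * tau))%N.
  rewrite -(ler_nat R) natrM natrB // natrM.
  apply: (@le_trans _ _ (K%:R * eps * tau%:R)); first by rewrite ler_peMl // ltW.
  by rewrite -mulrA ler_pM2l //; lra.
have [|m [T [n_le pow_le]]] := long_encoding _ le_n tau_le sync; first by lia.
exists T.
have ln2_gt0 : 0 < ln 2 :> R by rewrite ln_gt0 ?ltr1n.
have lnt_ge0 : 0 <= ln tau%:R :> R by rewrite ln_ge0 ?ler1n.
have : ln ((tau ^ m)%:R : R) <= ln ((2 ^ (2 * size (E T) * K))%:R : R).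
  by rewrite ler_ln ?posrE ?ltr0n ?expn_gt0 ?tau_gt0 // ler_nat.
rewrite !natrX !lnXn ?ltr0n // -[ln tau%:R *+ m]mulr_natl -[ln 2 *+ _]mulr_natl => ln_le.
have ratio_le : n%:R / tau%:R <= 8 * m%:R :> R.
  by rewrite ler_pdivrMr // -mulrA -!natrM ler_nat.
rewrite mulrC ler_pdivrMr ?mulr_gt0 // mulrA ler_pdivrMr //.
apply: (le_trans (ler_wpM2r lnt_ge0 ratio_le)).
have -> : (size (E T))%:R * (16 * K%:R) * ln 2
        = 8 * ((2 * size (E T) * K)%:R * ln 2) :> R by rewrite !natrM; lra.
by rewrite -mulrA ler_pM2l.
Qed.
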